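(* Consider a node in the OPM search tree with partial mapping $f_\rho$ and let $\mathcal{J}^{\mathrm{assigned}}_\rho \subseteq \mathcal{J}$ denote the set of pieces assigned by $f_\rho$. If there exists a piece $j \in \mathcal{J}^{\mathrm{fix}} \cap \mathcal{J}^{\mathrm{assigned}}_\rho$ such that $f_\rho(j) \neq \phi(j)$, then the node is infeasible and can be pruned, i.e., no complete OPM extending $f_\rho$ is feasible.
   Context: **Placements.** Items are rectangles with positive side lengths. A placement of an item in the loading space $[0,W]\times[0,L]$ is a bottom-left corner $(x,y)$ and a $90^\circ$-rotation indicator. A verified feasible packing plan of an item set $\mathcal I$ is given, in which items lie in the loading space without overlap (disjoint interiors); the bin of an item $i\in\mathcal I$ is the rectangle it occupies in this plan. $\mathcal J$ is a set of pieces (rectangular items) to be placed into the bins. **Tree.** The sets $\mathcal J=(j_1,\dots,j_{|\mathcal J|})$ and $\mathcal I=(i_1,\dots,i_{|\mathcal I|})$ are ordered by the same rule (both reverse pickup order, or both delivery order); bins are compared by position in the sequence. An order-preserving mapping (OPM) is a non-decreasing function $f:\mathcal J\to\mathcal I$. The OPM search tree is the rooted tree whose nodes at depth $\rho$ are the non-decreasing maps $f_\rho:\{j_1,\dots,j_\rho\}\to\mathcal I$ (partial OPMs), the root being the empty map and the children of $f_{\rho}$ being obtained by assigning $j_{\rho+1}$ to a bin not smaller than $f_{\rho}(j_{\rho})$ (any bin if $\rho=0$). Extensions keep all previous assignments. **Inherited placements.** $\mathcal{J}^{\mathrm{fix}}\subseteq\mathcal{J}$ is the set of shared pieces whose placements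 are inherited from earlier packing plans on the same route and are therefore fixed: in any feasible realization, each $j\in\mathcal{J}^{\mathrm{fix}}$ must keep exactly its inherited coordinates and orientation (consistent-placement requirement). For each $j\in\mathcal{J}^{\mathrm{fix}}$, $\phi(j)\in\mathcal I$ denotes the bin that contains the inherited placement of $j$. **Feasibility.** A complete OPM $f$ is feasible if the pieces can be placed so that each piece $j$ lies inside its bin $f(j)$, the pieces assigned to a common bin do not overlap and satisfy the accessibility requirement within the bin (for two pieces $j,j'$ of the same bin such that $j$ is picked up later or delivered earlier than $j'$, the $x$-ranges of $j$ and $j'$ do not overlap or $j$ starts at a $y$-coordinate at least the upper $y$-coordinate of $j'$), and every piece of $\mathcal J^{\mathrm{fix}}$ is at its inherited placement. A node is infeasible if no complete OPM extending its partial mapping is feasible. *)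

(* Defs.v *)
From HB Require Import structures.
From mathcomp Require Import all_boot all_order all_algebra.
From mathcomp Require Import all_classical all_reals all_analysis.

Set Implicit Arguments.
Unset Strict Implicit.
Unset Printing Implicit Defensive.

Import Order.TTheory GRing.Theory Num.Theory numFieldNormedType.Exports.

Local Open Scope classical_set_scope.
Local Open Scope ring_scope.

(** * Items and placements *)

(** [pickup] and [delivery] are positions along the route; ties are allowed,
    so several items may share a stop. *)
Record item (R : realType) := Item {
  item_width : R;
  item_length : R;
  item_width_gt0 : 0 < item_width;
  item_length_gt0 : 0 < item_length;
  pickup : nat;
  delivery : nat }.

Record placement (R : realType) := Placement {
  xpos : R;
  ypos : R;
  rotated : bool }.

Section Geometry.
Variable R : realType.
Implicit Types (a b : item R) (p q : placement R).

(** Side lengths along the two axes once the rotation is taken into account. *)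
Definition xside a p : R := if rotated p then item_length a else item_width a.
Definition yside a p : R := if rotated p then item_width a else item_length a.

Definition xrange a p : set R := `[xpos p, xpos p + xside a p].
Definition yrange a p : set R := `[ypos p, ypos p + yside a p].
Definition occupied a p : set (R * R)%type := xrange a p `*` yrange a p.

Definition loading_space (W L : R) : set (R * R)%type := `[0, W] `*` `[0, L].

(** Touching along the boundary does not count as an overlap. *)
Definition disjoint_interiors (T : topologicalType) (A B : set T) : Prop :=
  interior A `&` interior B = set0.

Definition packing_plan (W L : R) (m : nat) (it : 'I_m -> item R)
    (plan : 'I_m -> placement R) : Prop :=
  (forall i, occupied (it i) (plan i) `<=` loading_space W L) /\
  (forall i i', i != i' ->
     disjoint_interiors (occupied (it i) (plan i)) (occupied (it i') (plan i'))).

Definition later_pickup_or_earlier_delivery a b : Prop :=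
  (pickup b < pickup a)%N \/ (delivery a < delivery b)%N.

Definition accessible a p b q : Prop :=
  later_pickup_or_earlier_delivery a b ->
  disjoint_interiors (xrange a p) (xrange b q) \/
  ypos q + yside b q <= ypos p.

End Geometry.

(** * Item orders *)

Inductive ordering_rule := ReversePickup | DeliveryOrder.

Definition ordered_by (R : realType) (r : ordering_rule) (n : nat)
    (it : 'I_n -> item R) : Prop :=
  forall k k' : 'I_n, (k <= k')%N ->
  match r with
  | ReversePickup => (pickup (it k') <= pickup (it k))%N
  | DeliveryOrder => (delivery (it k) <= delivery (it k'))%N
  end.

(** * Order-preserving mappings and their search tree

    Pieces and bins are identified with their 0-based positions in the two
    sequences. A partial mapping sends the unassigned pieces to [None]. *)

Definition opm (n m : nat) (f : 'I_n -> 'I_m) : Prop :=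
  {homo f : j j' / (j <= j')%N}.

Definition partial_map (n m : nat) := 'I_n -> option 'I_m.

Section SearchTree.
Variables n m : nat.
Implicit Types (f g : partial_map n m) (rho : nat).

Definition assigned f : {set 'I_n} := finset (fun j => f j != None).

Definition opm_node rho f : Prop :=
  [/\ (rho <= n)%N,
      forall j, (j \in assigned f) = (j < rho)%N &
      forall j j' i i', f j = Some i -> f j' = Some i' ->
        (j <= j')%N -> (i <= i')%N].

Definition opm_root : partial_map n m := fun=> None.

(** [j] is the first piece not assigned at depth [rho]. *)
Definition opm_child rho f g : Prop :=
  exists (j : 'I_n) (i : 'I_m),
  [/\ j = rho :> nat,
      forall (k : 'I_n) b, k.+1 = rho -> f k = Some b -> (b <= i)%N &
      forall k, g k = if k == j then Some i else f k].

Definition extends (h : 'I_n -> 'I_m) f : Prop :=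
  forall j, j \in assigned f -> f j = Some (h j).

Lemma opm_node0 f : opm_node 0 f <-> f = opm_root.
Proof.
split=> [[_ asg _]|->]; last by split=> // j; rewrite inE.
by apply: funext => j; have := asg j; rewrite inE ltn0 /opm_root; case: (f j).
Qed.

Lemma opm_nodeS rho g :
  opm_node rho.+1 g <-> exists2 f, opm_node rho f & opm_child rho f g.
Proof.
split=> [[ltn asg mono]|[f [_ asg mono] [j [i [jE last gE]]]]].
- exists (fun k : 'I_n => if (k < rho)%N then g k else None).
    split=> [|k|j j' i i']; first exact: ltnW.
      rewrite inE; case: ltnP => // kr.
      by have := asg k; rewrite inE ltnS (ltnW kr).
    by case: ifP => // _ gj; case: ifP => // _ gj'; exact: mono gj gj'.
  have := asg (Ordinal ltn); rewrite inE /= ltnSn.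
  case gr : (g _) => [i|] // _; exists (Ordinal ltn), i; split=> // [k b kr|k].
    by rewrite -kr ltnSn => gk; apply: mono gk gr _; rewrite /= -kr.
  case: eqP => [->//|/eqP kr]; case: ltnP => // rk.
  have := asg k; rewrite inE ltnS leqNgt ltn_neqAle rk andbT.
  have -> /= : rho != k by rewrite eq_sym.
  by case: (g k).
- have dom k : (f k != None) = (k < rho)%N by rewrite -asg inE.
  have lef k b : f k = Some b -> (b <= i)%N.
    move=> fk; have kr : (k < rho)%N by rewrite -dom fk.
    have rn : (rho.-1 < n)%N.
      by rewrite (leq_ltn_trans (leq_pred _)) // -jE.
    have rS : rho.-1.+1 = rho by rewrite prednK // (leq_ltn_trans _ kr).
    have := dom (Ordinal rn); rewrite /= rS leqnn.
    case fr : (f _) => [c|] // _.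
    have bc : (b <= c)%N by apply: mono fk fr _; rewrite /= -ltnS rS.
    exact: leq_trans bc (last (Ordinal rn) c rS fr).
  split=> [|k|k k' b b']; first by rewrite -jE.
    rewrite inE gE ltnS leq_eqVlt -jE (inj_eq val_inj).
    by case: (k == j) => //=; rewrite jE; apply: dom.
  rewrite !gE; case: (k =P j) => [->|_]; case: (k' =P j) => [->|_].
  + by move=> [<-] [<-].
  + move=> _ fk'; rewrite leqNgt; have : (k' < rho)%N by rewrite -dom fk'.
    by rewrite jE => ->.
  + by move=> fk [<-] _; exact: lef fk.
  + exact: mono.
Qed.

End SearchTree.

(** * Feasibility *)

Section Feasibility.
Variables (R : realType) (n m : nat).
Variables (piece : 'I_n -> item R) (bin : 'I_m -> set (R * R)%type).
Variables (Jfix : {set 'I_n}) (inherited : 'I_n -> placement R).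

Definition realizes (f : 'I_n -> 'I_m) (pl : 'I_n -> placement R) : Prop :=
  [/\ forall j, occupied (piece j) (pl j) `<=` bin (f j),
      forall j j', j != j' -> f j = f j' ->
        disjoint_interiors (occupied (piece j) (pl j))
                           (occupied (piece j') (pl j')),
      forall j j', f j = f j' ->
        accessible (piece j) (pl j) (piece j') (pl j') &
      forall j, j \in Jfix -> pl j = inherited j].

Definition feasible (f : 'I_n -> 'I_m) : Prop := exists pl, realizes f pl.

Definition infeasible_node (f : partial_map n m) : Prop :=
  forall h : 'I_n -> 'I_m, opm h -> extends h f -> ~ feasible h.

End Feasibility.

(* Main.v *)
Require Import Defs.
From HB Require Import structures.
From mathcomp Require Import all_boot all_order all_algebra.
From mathcomp Require Import all_classical all_reals all_analysis.
From mathcomp Require Import lra.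

(** A fixed piece occupies its inherited rectangle in every feasible realization,
    and a rectangle with positive sides has interior points.  An extension of the
    node would put these interior points both in the bin [phi j] and in the
    different bin chosen by the node, whereas distinct bins of a packing plan have
    disjoint interiors.  So a piece fits in at most one bin
    ([occupied_in_one_bin]), and the mismatch is contradictory. *)

Set Implicit Arguments.
Unset Strict Implicit.
Unset Printing Implicit Defensive.

Import Order.TTheory GRing.Theory Num.Theory numFieldNormedType.Exports.

Local Open Scope classical_set_scope.
Local Open Scope ring_scope.

Lemma nbhs_itv_midpoint (R : realType) (x w : R) :
  0 < w -> nbhs (x + w / 2) `[x, x + w]%classic.
Proof.
move=> w0; apply: filterS (near_in_itvoo (a := x) (b := x + w) _).
  exact: subset_itv_oo_cc.
by rewrite in_itv /=; apply/andP; split; lra.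
Qed.

Lemma interior_occupied_neq0 (R : realType) (a : item R) (p : placement R) :
  interior (occupied a p) !=set0.
Proof.
exists (xpos p + xside a p / 2, ypos p + yside a p / 2).
exists (xrange a p, yrange a p) => //; split; apply: nbhs_itv_midpoint.
  by rewrite /xside; case: ifP => _; [exact: item_length_gt0|exact: item_width_gt0].
by rewrite /yside; case: ifP => _; [exact: item_width_gt0|exact: item_length_gt0].
Qed.

(** Bins may touch along their boundaries, so a common point of two bins is no
    contradiction; a common interior point is, and the positive side lengths of
    the piece provide one. *)
Lemma occupied_in_one_bin (R : realType) (W L : R) (m : nat)
    (container : 'I_m -> item R) (plan : 'I_m -> placement R)
    (a : item R) (p : placement R) (i i' : 'I_m) :
  packing_plan W L container plan ->
  occupied a p `<=` occupied (container i) (plan i) ->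
  occupied a p `<=` occupied (container i') (plan i') ->
  i = i'.
Proof.
move=> [_ disj] in_i in_i'; apply/eqP/negP => /negP /disj bins_disj.
have [z az] := interior_occupied_neq0 a p.
suff : set0 z by [].
by rewrite -bins_disj; split; [exact: interiorS in_i z az|exact: interiorS in_i' z az].
Qed.

Theorem proposition5 (R : realType) (W L : R) (n m : nat)
    (piece : 'I_n -> item R) (container : 'I_m -> item R)
    (plan : 'I_m -> placement R)
    (hplan : packing_plan W L container plan)
    (rule : ordering_rule)
    (hpiece : ordered_by rule piece) (hcontainer : ordered_by rule container)
    (Jfix : {set 'I_n}) (inherited : 'I_n -> placement R) (phi : 'I_n -> 'I_m)
    (hphi : forall j, j \in Jfix ->
       occupied (piece j) (inherited j) `<=`
       occupied (container (phi j)) (plan (phi j)))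
    (rho : nat) (f : partial_map n m) (hf : opm_node rho f)
    (hmismatch : exists j, [/\ j \in Jfix, j \in assigned f &
                               f j <> Some (phi j)]) :
  infeasible_node piece (fun i => occupied (container i) (plan i))
    Jfix inherited f.
Proof.
move=> h _ h_ext [pl [pl_in_bin _ _ pl_fixed]].
have [j [j_fix j_asg]] := hmismatch; apply.
rewrite (h_ext _ j_asg); congr Some.
apply: (occupied_in_one_bin hplan _ (hphi _ j_fix)).
by rewrite -(pl_fixed _ j_fix); exact: pl_in_bin.
Qed.
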